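(* Let $\|\cdot\|_a$ be a norm on $\mathbb{R}^d$ and let $\mu$ be a $\Gamma_d(\alpha,\beta)$ distribution with $\alpha$ a finite measure on $\mathbf{S}_{\mathbb{R}^d,\|\cdot\|_a}$ and $\beta:\mathbf{S}_{\mathbb{R}^d,\|\cdot\|_a}\to\mathbb{R}_+$ measurable. If $\|\cdot\|_b$ is another norm on $\mathbb{R}^d$, then $\mu$ is a $\Gamma_d(\alpha_b,\beta_b)$ distribution with $\alpha_b$ a finite measure on $\mathbf{S}_{\mathbb{R}^d,\|\cdot\|_b}$ and $\beta_b:\mathbf{S}_{\mathbb{R}^d,\|\cdot\|_b}\to\mathbb{R}_+$ measurable. Moreover, $$\alpha_b(E)=\int_{\mathbf{S}_{\mathbb{R}^d,\|\cdot\|_a}}1_E\left(\frac{v}{\|v\|_b}\right)\alpha(\mathrm{d}v)\quad\forall E\in\mathcal{B}(\mathbf{S}_{\mathbb{R}^d,\|\cdot\|_b}),$$ $$\beta_b(v_b)=\beta\left(\frac{v_b}{\|v_b\|_a}\right)\|v_b\|_a\quad\forall v_b\in\mathbf{S}_{\mathbb{R}^d,\|\cdot\|_b}.$$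
   Context: $\mathbb{R}_+=[0,\infty)$ and $\mathbf{S}_{\mathbb{R}^d,\|\cdot\|}=\{v\in\mathbb{R}^d:\|v\|=1\}$. For a finite Borel measure $\alpha$ on $\mathbf{S}_{\mathbb{R}^d,\|\cdot\|}$ and a Borel function $\beta:\mathbf{S}_{\mathbb{R}^d,\|\cdot\|}\to\mathbb{R}_+$, an infinitely divisible probability measure $\mu$ on $\mathbb{R}^d$ is called a $d$-dimensional Gamma distribution $\Gamma_d(\alpha,\beta)$ (with respect to the norm $\|\cdot\|$) if its characteristic function is $$\hat\mu(z)=\int e^{iz^\top x}\mu(\mathrm{d}x)=\exp\left(\int_{\mathbf{S}_{\mathbb{R}^d,\|\cdot\|}}\int_{\mathbb{R}_+}\left(e^{irv^\top z}-1\right)\frac{e^{-\beta(v)r}}{r}\,\mathrm{d}r\,\alpha(\mathrm{d}v)\right),\quad z\in\mathbb{R}^d.$$ *)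

(* Defs.v *)
From HB Require Import structures.
From mathcomp Require Import all_boot all_order all_algebra.
From mathcomp Require Import complex.
From mathcomp Require Import all_classical all_reals all_analysis.

Set Implicit Arguments.
Unset Strict Implicit.
Unset Printing Implicit Defensive.

Import Order.TTheory GRing.Theory Num.Theory.
Import numFieldNormedType.Exports.

Local Open Scope classical_set_scope.
Local Open Scope ring_scope.
Local Open Scope complex_scope.

(* The norms on V are explicit objects, rather than a [normedModType]
   structure on V, because two of them are compared on the same space. *)
Record norm_on (R : realType) (V : lmodType R) := NormOn {
  norm_fun :> V -> R;
  norm_triangle : forall x y, norm_fun (x + y) <= norm_fun x + norm_fun y;
  norm_homogeneous : forall (a : R) x, norm_fun (a *: x) = `|a| * norm_fun x;
  norm_definite : forall x, norm_fun x = 0 -> x = 0 }.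

Lemma norm_on0 (R : realType) (V : lmodType R) (N : norm_on V) : N 0 = 0.
Proof. by rewrite -(scale0r 0) norm_homogeneous normr0 mul0r. Qed.

Lemma norm_on_ge0 (R : realType) (V : lmodType R) (N : norm_on V) (x : V) :
  0 <= N x.
Proof.
have := norm_triangle N x (- x).
rewrite subrr norm_on0 -scaleN1r norm_homogeneous normrN normr1 mul1r.
by rewrite -mulr2n pmulrn_lge0.
Qed.

Lemma norm_on_gt0 (R : realType) (V : lmodType R) (N : norm_on V) (x : V) :
  x != 0 -> 0 < N x.
Proof.
move=> x0; rewrite lt_neqAle norm_on_ge0 andbT eq_sym.
by apply: contra_neq x0; exact: norm_definite.
Qed.

Lemma norm_on_unit (R : realType) (V : lmodType R) (N : norm_on V) (x : V) :
  x != 0 -> N ((N x)^-1 *: x) = 1.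
Proof.
move=> /(norm_on_gt0 N) Nx.
by rewrite norm_homogeneous normfV gtr0_norm// mulVf// gt_eqF.
Qed.

(* R^d for d >= 1, as column vectors: d is the successor of the index n. *)
Definition sphere (R : realType) (n : nat) (N : norm_on 'cV[R]_n.+1) : Type :=
  set_type [set v : 'cV[R]_n.+1 | N v = 1].

Definition sphere_val (R : realType) (n : nat) (N : norm_on 'cV[R]_n.+1)
  (v : sphere N) : 'cV[R]_n.+1 := set_val v.

Lemma sphere_neq0 (R : realType) (n : nat) (N : norm_on 'cV[R]_n.+1)
  (v : sphere N) : sphere_val v != 0.
Proof.
have Nv : N (sphere_val v) = 1 by case: v => x /= /[dup] /set_mem.
by apply: contra_eq_neq Nv => ->; rewrite norm_on0 eq_sym oner_neq0.
Qed.

Definition sphere_of (R : realType) (n : nat) (N : norm_on 'cV[R]_n.+1)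
    (v : 'cV[R]_n.+1) (v0 : v != 0) : sphere N :=
  exist _ ((N v)^-1 *: v) (mem_set (norm_on_unit N v0)).

Definition renormalize (R : realType) (n : nat) (M N : norm_on 'cV[R]_n.+1)
  (v : sphere M) : sphere N := sphere_of N (sphere_neq0 v).

Lemma const_mx1_neq0 (R : realType) (n : nat) :
  const_mx 1 != 0 :> 'cV[R]_n.+1.
Proof.
by apply/eqP => /matrixP/(_ 0 0); rewrite !mxE => /eqP; rewrite oner_eq0.
Qed.

(* the subspace topology, from [subtype_topology] *)
HB.instance Definition _ (R : realType) (n : nat) (N : norm_on 'cV[R]_n.+1) :=
  Topological.copy (sphere N)
    (set_type [set v : 'cV[R]_n.+1 | N v = 1]).
HB.instance Definition _ (R : realType) (n : nat) (N : norm_on 'cV[R]_n.+1) :=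
  isPointed.Build (sphere N) (sphere_of N (const_mx1_neq0 R n)).

Notation borel T := (g_sigma_algebraType (@open T)).

Definition cexp (R : realType) (w : R[i]) : R[i] :=
  (expR (complex.Re w) * cos (complex.Im w)) +i*
  (expR (complex.Re w) * sin (complex.Im w)).

(* Meaningful when f is absolutely integrable: the real-valued integrals
   return junk on infinite values. *)
Definition cintegral (d : measure_display) (T : measurableType d) (R : realType)
    (mu : {measure set T -> \bar R}) (D : set T) (f : T -> R[i]) : R[i] :=
  (\int[mu]_(x in D) complex.Re (f x)) +i* (\int[mu]_(x in D) complex.Im (f x)).

Definition dotv (R : realType) (n : nat) (x y : 'cV[R]_n) : R :=
  (x^T *m y) 0 0.

Definition charfun (R : realType) (n : nat)
    (mu : probability (borel 'cV[R]_n.+1) R) (z : 'cV[R]_n.+1) : R[i] :=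
  cintegral mu setT (fun x : 'cV[R]_n.+1 => cexp ('i * (dotv z x)%:C)).

(* (mu * nu)(A) = \int nu(A - x) mu(dx) *)
Definition convolution (R : realType) (n : nat)
    (mu : {measure set (borel 'cV[R]_n.+1) -> \bar R})
    (nu : set 'cV[R]_n.+1 -> \bar R) (A : set 'cV[R]_n.+1) : \bar R :=
  (\int[mu]_x nu [set y : 'cV[R]_n.+1 | A (x + y)%R])%E.

Fixpoint conv_pow (R : realType) (n : nat)
    (mu : {measure set (borel 'cV[R]_n.+1) -> \bar R}) (k : nat)
    : set 'cV[R]_n.+1 -> \bar R :=
  if k is k'.+1 then convolution mu (conv_pow mu k')
  else @dirac _ (borel 'cV[R]_n.+1) 0 R.

Definition infinitely_divisible (R : realType) (n : nat)
    (mu : probability (borel 'cV[R]_n.+1) R) : Prop :=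
  forall k : nat, (0 < k)%N ->
    exists nu : probability (borel 'cV[R]_n.+1) R,
      forall A : set (borel 'cV[R]_n.+1), measurable A ->
        mu A = conv_pow nu k A.

Definition gamma_integrand (R : realType) (n : nat) (N : norm_on 'cV[R]_n.+1)
    (beta : sphere N -> R) (z : 'cV[R]_n.+1) (v : sphere N) (r : R) : R[i] :=
  (cexp ('i * (r * dotv (sphere_val v) z)%:C) - 1) *
  (expR (- beta v * r) / r)%:C.

(* The first condition says that the double integral in the exponent exists,
   i.e. converges absolutely; it fails for some alpha and beta, e.g. when beta
   vanishes on a set of positive alpha-measure.
   In R[i], `|w| is the modulus seen as a complex number. *)
Definition is_Gamma (R : realType) (n : nat) (N : norm_on 'cV[R]_n.+1)
    (alpha : {finite_measure set (borel (sphere N)) -> \bar R})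
    (beta : sphere N -> R) (mu : probability (borel 'cV[R]_n.+1) R) : Prop :=
  [/\ forall z : 'cV[R]_n.+1,
        (\int[alpha]_v \int[lebesgue_measure]_(r in `[0%R, +oo[)
           (complex.Re `|gamma_integrand beta z v r|)%:E < +oo)%E,
      infinitely_divisible mu
    & forall z : 'cV[R]_n.+1,
        charfun mu z = cexp (cintegral alpha setT (fun v =>
          cintegral (@lebesgue_measure R) `[0%R, +oo[
            (gamma_integrand beta z v)))].

(* Main.v *)
(* Write v_b = v / ||v||_b for v on the a-sphere and c = ||v||_b. The Lévy
   density along the ray through v is the same whether the ray is parametrized
   by v or by v_b: the radii are related by r_b = c r, the measure dr / r is
   invariant under this scaling, and the rate changes from beta(v) to
   beta(v) / c, which is beta_b(v_b). Hence the inner integrals agree, and the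
   outer one is transported by the homeomorphism v |-> v_b, which pushes alpha
   forward to alpha_b. *)

Require Import Defs.
From HB Require Import structures.
From mathcomp Require Import all_boot all_order all_algebra.
From mathcomp Require Import complex.
From mathcomp Require Import all_classical all_reals all_analysis.
From mathcomp Require Import measurable_realfun.

Set Implicit Arguments.
Unset Strict Implicit.
Unset Printing Implicit Defensive.

Import Order.TTheory GRing.Theory Num.Theory.
Import numFieldNormedType.Exports.

Local Open Scope classical_set_scope.
Local Open Scope ring_scope.

(** * Change of variables for integrals *)

Section change_of_variables.
Local Open Scope ereal_scope.
Context {R : realType}.

Import HBNNSimple.

(** A simple function [h] below [f] pulls back to the simple function [c * h \o phi] below
    [c * f \o phi], with the same integral; the bound follows by taking suprema over [h]. As [f] is
    arbitrary, this later applies to inner integrals as functions of the direction. *)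
Lemma ge0_integral_scaled_le d1 d2 (X : measurableType d1)
    (Y : measurableType d2) (mu : {measure set X -> \bar R})
    (nu : {measure set Y -> \bar R})
    (phi : X -> Y) (c : R) (f : Y -> \bar R) :
  measurable_fun setT phi -> (0 <= c)%R ->
  (forall B, measurable B -> nu B = c%:E * mu (phi @^-1` B)) ->
  (forall y, 0 <= f y) ->
  \int[nu]_y f y <= \int[mu]_x (c%:E * f (phi x)).
Proof.
move=> mphi c0 nuE f0.
have cf0 x : 0 <= c%:E * f (phi x) by rewrite mule_ge0// lee_fin.
rewrite !ge0_integralTE//; apply: ge_ereal_sup => _ [h/= hf <-].
pose phi_mixin := isMeasurableFun.Build _ _ _ _ _ mphi.
pose phi' : {mfun X >-> Y} := HB.pack phi phi_mixin.
have fin_hphi : finite_set (range (h \o phi)).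
  by apply: (sub_finite_set _ (fimfunP h)) => _ [x _ <-]; exists (phi x).
have hphi0 x : (0 <= (h \o phi) x)%R by exact: fun_ge0.
pose hphi : {nnsfun X >-> R} := HB.pack (h \o phi')
  (FiniteImage.Build _ _ _ fin_hphi) (isNonNegFun.Build _ _ _ hphi0).
apply: ereal_sup_ubound; exists (scale_nnsfun hphi c0) => /=.
  by move=> x; rewrite EFinM lee_wpmul2l ?lee_fin// hf.
rewrite [LHS](sintegralrM mu c hphi) !sintegralET ge0_mule_fsumr; last first.
  by move=> r; exact: (nnsfun_mulemu_ge0 mu hphi).
by apply: eq_fsbigr => r _; rewrite nuE// muleCA.
Qed.

(* A measurable bijection with measurable inverse matches the simple functions
   below [f] with those below [c * f \o phi], whatever [f] is. *)
Lemma integral_scaled d1 d2 (X : measurableType d1) (Y : measurableType d2)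
    (mu : {measure set X -> \bar R}) (nu : {measure set Y -> \bar R})
    (phi : X -> Y) (psi : Y -> X) (c : R) (D : set Y) (f : Y -> \bar R) :
  measurable_fun setT phi -> measurable_fun setT psi ->
  cancel phi psi -> cancel psi phi -> (0 < c)%R ->
  (forall B, measurable B -> nu B = c%:E * mu (phi @^-1` B)) ->
  \int[nu]_(y in D) f y = \int[mu]_(x in phi @^-1` D) (c%:E * f (phi x)).
Proof.
move=> mphi mpsi phiK psiK c0 nuE.
(* The inverse map [psi] satisfies the same scaling relation with constant [c^-1], so the one-sided
   bound is available in both directions. *)
have muE A : measurable A -> mu A = c^-1%:E * nu (psi @^-1` A).
  move=> mA; rewrite nuE; last by rewrite -[_ @^-1` _]setTI; exact: mpsi.
  rewrite muleA -EFinM mulVf ?gt_eqF// mul1e -comp_preimage.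
  by rewrite (_ : psi \o phi = id) ?preimage_id//; apply/funext => x /=.
have ge0T g : (forall y, 0 <= g y) ->
    \int[nu]_y g y = \int[mu]_x (c%:E * g (phi x)).
  move=> g0; apply/eqP; rewrite eq_le; apply/andP; split.
    by apply: ge0_integral_scaled_le => //; exact: ltW.
  have cg0 x : 0 <= c%:E * g (phi x) by rewrite mule_ge0// lee_fin ltW.
  apply: (le_trans (ge0_integral_scaled_le mpsi _ muE cg0)).
    by rewrite invr_ge0 ltW.
  rewrite le_eqVlt; apply/orP; left; apply/eqP; apply: eq_integral => y _.
  by rewrite muleA -EFinM mulVf ?gt_eqF// mul1e psiK.
(* The domain is absorbed into the integrand, and the sign is handled by positive and negative
   parts, which commute with multiplication by [c > 0]. *)
rewrite integral_mkcond [RHS]integral_mkcond.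
have -> : (fun x => c%:E * f (phi x)) \_ (phi @^-1` D) =
    (fun x => c%:E * (f \_ D) (phi x)).
  apply/funext => x; rewrite !patchE.
  have -> : (x \in phi @^-1` D) = (phi x \in D) by apply/idP/idP; rewrite !inE.
  by case: ifP; rewrite ?mule0.
rewrite integralE [RHS]integralE !ge0T//; congr (_ - _).
  rewrite (ge0_funeposM _ (ltW c0)).
  by apply: eq_integral => x _; rewrite !funeposE.
rewrite (ge0_funenegM _ (ltW c0)).
by apply: eq_integral => x _; rewrite !funenegE.
Qed.

(** By uniqueness of Lebesgue measure, it suffices to compare on half-open intervals: the preimage
    of []a, b]] is []a / c, b / c]], whose length times [c] is that of []a, b]]. *)
Lemma lebesgue_measure_scale (c : R) : (0 < c)%R ->
  forall B : set (measurableTypeR R), measurable B ->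
  lebesgue_measure B = c%:E * lebesgue_measure ( *%R c @^-1` B).
Proof.
move=> c0 B mB.
have mc : measurable_fun setT ( *%R c : measurableTypeR R -> measurableTypeR R).
  exact: measurable_funM.
rewrite (lebesgue_measure_unique (mu := mscale (NngNum (ltW c0))
  (pushforward lebesgue_measure
    ( *%R c : measurableTypeR R -> measurableTypeR R))))// => _ [[a b]] _ <-.
rewrite /= /mscale /= /pushforward.
have -> : *%R c @^-1` `]a, b] = `](a / c)%R, (b / c)%R]%classic.
  apply/seteqP; split => x /=; rewrite !in_itv/= ltr_pdivrMr// ler_pdivlMr//;
  by rewrite ![(x * c)%R]mulrC.
rewrite !lebesgue_measure_itv/= !lte_fin ltr_pM2r ?invr_gt0//.
case: ifPn => _; last by rewrite mule0.
by rewrite -!EFinD -EFinM -mulrBl mulrC divfK// gt_eqF.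
Qed.

(** Radial substitution: multiplication by [c] maps the half-line onto itself and contributes the
    Jacobian [c]. *)
Lemma integral_itv0y_scale (c : R) (f : R -> \bar R) : (0 < c)%R ->
  \int[lebesgue_measure]_(r in `[0%R, +oo[) f r =
  \int[lebesgue_measure]_(r in `[0%R, +oo[) (c%:E * f (c * r)%R).
Proof.
move=> c0.
have c_neq0 : c != 0%R by rewrite gt_eqF.
have mmul (a : R) :
    measurable_fun setT ( *%R a : measurableTypeR R -> measurableTypeR R).
  exact: measurable_funM.
rewrite (integral_scaled _ _ (mmul c) (mmul c^-1%R) (mulKf c_neq0)
  (mulVKf c_neq0) c0 (lebesgue_measure_scale c0)).
congr (integral _ _ _); apply/seteqP; split => x /=;
by rewrite !in_itv/= !andbT pmulr_rge0.
Qed.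

End change_of_variables.

(** * Borel measurability of continuous maps *)

Lemma continuous_measurable_fun_borel (T U : ptopologicalType) (f : T -> U) :
  continuous f -> measurable_fun setT (f : borel T -> borel U).
Proof.
move=> /continuousP cf.
apply: (@measurability _ _ (borel T) (borel U) _ _ (@open U) erefl).
move=> _ [B oB <-]; rewrite setTI; apply: sub_sigma_algebra; exact: cf.
Qed.

(** Here the target carries the standard sigma-algebra of [R] rather than [borel R]; open intervals
    serve as its generators. *)
Lemma continuous_measurable_fun_real (R : realType) (T : ptopologicalType)
    (f : T -> R) :
  continuous f -> measurable_fun setT (f : borel T -> R).
Proof.
move=> /continuousP cf; apply: (measurability _ (RGenOpens.measurableE R)).
move=> _ [_ [a [b ->] <-]]; rewrite setTI.
by apply: sub_sigma_algebra; apply: cf; exact: interval_open.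
Qed.

(** * Continuity of norms and radial projection between unit spheres *)

Section norms.
Context {R : realType} {n : nat}.
Implicit Types (M N : norm_on 'cV[R]_n.+1) (x y : 'cV[R]_n.+1).

(** Expand [x] in the canonical basis, apply the triangle inequality, and bound each coordinate by
    the sup norm. *)
Lemma norm_on_le_mx_norm N x :
  N x <= (\sum_i N (delta_mx i 0)) * `|x|.
Proof.
have Nsum (F : 'I_n.+1 -> 'cV[R]_n.+1) : N (\sum_i F i) <= \sum_i N (F i).
  elim/big_ind2 : _ => [|u a v b ua vb|//]; first by rewrite norm_on0.
  exact: le_trans (norm_triangle _ _ _) (lerD ua vb).
rewrite {1}(matrix_sum_delta x) mulr_suml.
under eq_bigr do rewrite big_ord1.
apply: le_trans (Nsum _) _; apply: ler_sum => i _.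
rewrite norm_homogeneous mulrC ler_wpM2l ?norm_on_ge0//.
rewrite [leRHS]/Num.norm/= mx_normrE.
exact: (le_bigmax _ (fun ij => `|x ij.1 ij.2|) (i, 0)).
Qed.

(** The reverse triangle inequality makes [N] Lipschitz for the sup norm, which defines the
    topology. *)
Lemma continuous_norm_on N : continuous N.
Proof.
move=> x; set C := \sum_i N (delta_mx i 0).
have dN y : `|N x - N y| <= C * `|x - y|.
  have Nsub u v : N u - N v <= C * `|u - v|.
    apply: le_trans (norm_on_le_mx_norm N (u - v)).
    by rewrite lerBlDr -[in leLHS](subrK v u) norm_triangle.
  by rewrite ler_norml Nsub andbT lerNl opprB distrC Nsub.
(* Dividing by [C + 1] instead of [C] asks only for [0 <= C]. *)
have C1 : 0 < C + 1 by rewrite ltr_wpDl// sumr_ge0// => i _; exact: norm_on_ge0.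
apply/(@cvgrPdist_lt _ _ _ _ (nbhs_filter x)) => e e0; apply/nbhs_ballP.
exists (e / (C + 1)); first by rewrite /= divr_gt0.
move=> y; rewrite mx_norm_ball /ball_/= ltr_pdivlMr// mulrC => xy.
by apply: le_lt_trans xy; rewrite (le_trans (dN y))// ler_wpM2r ?lerDl.
Qed.

Lemma continuous_sphere_val N : continuous (@sphere_val R n N).
Proof. exact: initial_continuous. Qed.

Lemma norm_sphere_val N (v : sphere N) : N (sphere_val v) = 1.
Proof. by case: v => x /= /[dup] /set_mem. Qed.

Lemma sphere_val_inj N : injective (@sphere_val R n N).
Proof. exact: val_inj. Qed.

Lemma sphere_val_renormalize M N (v : sphere M) :
  sphere_val (renormalize N v) = (N (sphere_val v))^-1 *: sphere_val v.
Proof. by []. Qed.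

(** Since [M v = 1], the vector [v / N v] has [M]-norm [1 / N v], and dividing by it restores [v].
    Exchanging the norms shows that the two projections are mutually inverse. *)
Lemma renormalizeK M N : cancel (@renormalize R n M N) (renormalize M).
Proof.
move=> v; apply: sphere_val_inj.
have Nv0 := norm_on_gt0 N (sphere_neq0 v).
rewrite !sphere_val_renormalize norm_homogeneous norm_sphere_val mulr1.
rewrite scalerA ger0_norm ?invr_ge0 ?ltW//.
by rewrite mulVf ?scale1r// invr_neq0// gt_eqF.
Qed.

(** The sphere has the initial topology of [sphere_val], so it suffices that [v / N v] depends
    continuously on [v] as a vector; [N v] does not vanish on the sphere. *)
Lemma continuous_renormalize M N : continuous (@renormalize R n M N).
Proof.
have cNv : continuous (fun v : sphere M => N (sphere_val v)).
  by move=> v; apply: continuous_comp;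
    [exact: continuous_sphere_val|exact: continuous_norm_on].
apply: continuous_comp_initial => v.
apply: (@cvgZ _ _ _ _ (nbhs_filter v)
  (fun w : sphere M => (N (sphere_val w))^-1) (@sphere_val R n M)
  (N (sphere_val v))^-1 (sphere_val v)).
  apply: (@cvgV _ _ _ (nbhs_filter v) (fun w : sphere M => N (sphere_val w))).
    by rewrite gt_eqF// norm_on_gt0// sphere_neq0.
  exact: cNv.
exact: continuous_sphere_val.
Qed.

End norms.

(** * Invariance of the radial integrals *)

Section gamma_renormalize.
Local Open Scope complex_scope.
Context {R : realType} {n : nat} (Na Nb : norm_on 'cV[R]_n.+1).
Variable beta : sphere Na -> R.

(** This is [beta_b]; at the point [v / Nb v] with [v] on the [Na]-sphere it equals
    [beta v / Nb v]. *)
Definition renormalize_rate (v : sphere Nb) : R :=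
  beta (renormalize Na v) * Na (sphere_val v).

(** The factors [c] cancel in the phase and in the exponential decay; only [1 / r] leaves [c^-1],
    which the Jacobian of the radial substitution will absorb. *)
Lemma gamma_integrand_renormalize (z : 'cV[R]_n.+1) (v : sphere Na) (r : R) :
  let c := Nb (sphere_val v) in
  gamma_integrand renormalize_rate z (renormalize Nb v) (c * r) =
  (c^-1)%:C * gamma_integrand beta z v r.
Proof.
move=> c; have c0 : c != 0 by rewrite gt_eqF// norm_on_gt0// sphere_neq0.
have c_ge0 : 0 <= c by exact: norm_on_ge0.
rewrite /gamma_integrand /renormalize_rate renormalizeK sphere_val_renormalize.
rewrite -/c norm_homogeneous norm_sphere_val mulr1.
rewrite ger0_norm ?invr_ge0// /dotv linearZ/= -scalemxAl mxE.
set d := (_ *m _) 0 0.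
have -> : c * r * (c^-1 * d) = r * d by rewrite mulrACA divff// mul1r.
have -> : expR (- (beta v * c^-1) * (c * r)) / (c * r) =
    c^-1 * (expR (- beta v * r) / r).
  by rewrite -mulNr -mulrA mulKf// invfM mulrCA.
by rewrite [X in _ * X]rmorphM mulrCA.
Qed.

(** Positive homogeneity moves [c^-1] out of [h], where it meets the Jacobian [c]. Taking [h] to be
    the real part, the imaginary part or the modulus covers both the exponent and its absolute
    convergence. *)
Lemma integral_gamma_integrand_renormalize (z : 'cV[R]_n.+1) (v : sphere Na)
    (h : R[i] -> R) :
  (forall (a : R) w, 0 < a -> h (a%:C * w) = a * h w) ->
  (\int[lebesgue_measure]_(r in `[0%R, +oo[)
     (h (gamma_integrand renormalize_rate z (renormalize Nb v) r))%:E =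
   \int[lebesgue_measure]_(r in `[0%R, +oo[)
     (h (gamma_integrand beta z v r))%:E)%E.
Proof.
move=> hZ; have c0 := norm_on_gt0 Nb (sphere_neq0 v).
rewrite (integral_itv0y_scale _ c0); apply: eq_integral => r _.
rewrite gamma_integrand_renormalize hZ ?invr_gt0// -EFinM mulrA divff ?mul1r//.
by rewrite gt_eqF.
Qed.

Lemma cintegral_gamma_integrand_renormalize (z : 'cV[R]_n.+1) (v : sphere Na) :
  cintegral (@lebesgue_measure R) `[0%R, +oo[
    (gamma_integrand renormalize_rate z (renormalize Nb v)) =
  cintegral (@lebesgue_measure R) `[0%R, +oo[ (gamma_integrand beta z v).
Proof.
have ReZ (a : R) (w : R[i]) : 0 < a -> complex.Re (a%:C * w) = a * complex.Re w.
  by case: w => x y _; rewrite /= mul0r subr0.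
have ImZ (a : R) (w : R[i]) : 0 < a -> complex.Im (a%:C * w) = a * complex.Im w.
  by case: w => x y _; rewrite /= mul0r addr0.
rewrite /cintegral /Rintegral.
by rewrite (integral_gamma_integrand_renormalize z v ReZ)
  (integral_gamma_integrand_renormalize z v ImZ).
Qed.

End gamma_renormalize.

(** * Transport of the spherical measure *)

Lemma measurable_renormalize (R : realType) (n : nat)
    (Na Nb : norm_on 'cV[R]_n.+1) :
  measurable_fun setT (renormalize Nb : borel (sphere Na) -> borel (sphere Nb)).
Proof.
by apply: continuous_measurable_fun_borel; exact: continuous_renormalize.
Qed.

Section pushforward_renormalize.
Context {R : realType} {n : nat} {Na : norm_on 'cV[R]_n.+1}.
Variable Nb : norm_on 'cV[R]_n.+1.
Variable alpha : {finite_measure set (borel (sphere Na)) -> \bar R}.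

(** This is [alpha_b], named so that its measure and finiteness structures can be declared. *)
Definition pushforward_renormalize : set (borel (sphere Nb)) -> \bar R :=
  pushforward alpha (renormalize Nb : borel (sphere Na) -> borel (sphere Nb)).

HB.instance Definition _ := Measure.copy pushforward_renormalize
  (measure_function_pushforward__canonical__measure_function_Measure alpha
    (@measurable_renormalize R n Na Nb)).

Lemma pushforward_renormalize_fin : fin_num_fun pushforward_renormalize.
Proof.
move=> E mE; apply: fin_num_measure.
by rewrite -[_ @^-1` _]setTI; exact: measurable_renormalize.
Qed.

HB.instance Definition _ := Measure_isFinite.Build _ _ _
  pushforward_renormalize pushforward_renormalize_fin.

(** The case [c = 1] of [integral_scaled], the two projections being measurable and mutually
    inverse. *)
Lemma integral_renormalize (f : borel (sphere Nb) -> \bar R) :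
  (\int[pushforward_renormalize]_v f v = \int[alpha]_v f (renormalize Nb v))%E.
Proof.
have nuE (E : set (borel (sphere Nb))) : measurable E ->
    pushforward_renormalize E =
    (1%:E * alpha ((renormalize Nb : borel (sphere Na) -> _) @^-1` E))%E.
  by rewrite mul1e.
rewrite (integral_scaled setT f (@measurable_renormalize R n Na Nb)
  (@measurable_renormalize R n Nb Na) (@renormalizeK R n Na Nb)
  (@renormalizeK R n Nb Na) ltr01 nuE).
by apply: eq_integral => v _; rewrite mul1e.
Qed.

Lemma cintegral_renormalize (f : borel (sphere Nb) -> R[i]) :
  cintegral pushforward_renormalize setT f =
  cintegral alpha setT (fun v => f (renormalize Nb v)).
Proof. by rewrite /cintegral /Rintegral !integral_renormalize. Qed.

End pushforward_renormalize.

(** * The Gamma representation for the second norm *)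

Theorem proposition3p4 (R : realType) (n : nat)
    (Na Nb : norm_on 'cV[R]_n.+1)
    (mu : probability (borel 'cV[R]_n.+1) R)
    (alpha : {finite_measure set (borel (sphere Na)) -> \bar R})
    (beta : borel (sphere Na) -> R)
    (beta_ge0 : forall v, 0 <= beta v)
    (beta_meas : measurable_fun setT beta)
    (mu_Gamma : is_Gamma alpha beta mu) :
  exists (alpha_b : {finite_measure set (borel (sphere Nb)) -> \bar R})
         (beta_b : borel (sphere Nb) -> R),
    [/\ forall v, 0 <= beta_b v,
        measurable_fun setT beta_b,
        is_Gamma alpha_b beta_b mu,
        forall E : set (borel (sphere Nb)), measurable E ->
          alpha_b E = (\int[alpha]_v (\1_E (renormalize Nb v))%:E)%E
      & forall vb : sphere Nb,
          beta_b vb = beta (renormalize Na vb) * Na (sphere_val vb)].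
Proof.
exists (pushforward_renormalize alpha), (renormalize_rate beta).
case: mu_Gamma => abs_int inf_div charE; split => //.
- by move=> v; rewrite mulr_ge0// norm_on_ge0.
- apply: measurable_funM.
    exact: measurableT_comp beta_meas (@measurable_renormalize _ _ _ _).
  by apply: continuous_measurable_fun_real => v; apply: continuous_comp;
    [exact: continuous_sphere_val|exact: continuous_norm_on].
(* Infinite divisibility concerns [mu] alone and carries over; absolute convergence and the
   characteristic function remain. *)
- split => // z.
    (* After transport to the [Na]-sphere the double integral of the modulus equals the one that is
       finite by assumption. *)
    rewrite integral_renormalize; apply: le_lt_trans (abs_int z).
    rewrite le_eqVlt; apply/orP; left; apply/eqP; apply: eq_integral => v _.
    apply: (@integral_gamma_integrand_renormalize R n Na Nb beta z v
      (fun w => complex.Re `|w|)).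
    move=> a w a0; rewrite normrM (ger0_norm (x := _%:C)%C) ?ler0c ?ltW//.
    by rewrite normc_def /= mul0r subr0.
  rewrite charE; congr (cexp _).
  rewrite [RHS]cintegral_renormalize.
  apply: (congr1 (cintegral alpha setT)).
  by apply/funext => v; rewrite cintegral_gamma_integrand_renormalize.
(* Read backwards, the transport formula turns the right-hand side into the integral of [\1_E]
   against [alpha_b]. *)
- move=> E mE; rewrite -(integral_renormalize alpha (fun v => (\1_E v)%:E)).
  by rewrite integral_indic ?setIT.
Qed.
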